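(* Let $G$ be a finite simple undirected graph with $N \ge 3$ vertices, and let $U \subseteq V(G)$ be a given set of vertices (the vertices designated as unbounded). Let $G'$ be the graph obtained from $G$ as follows: each $u \in U$ is replaced by a cycle $C_u$ of length $N$ on $N$ new vertices (the cycles for distinct $u$ being disjoint), each vertex not in $U$ is kept; for every edge $xy$ of $G$, every vertex representing $x$ is joined by an edge to every vertex representing $y$, where the vertices representing $x$ are the vertices of $C_x$ if $x \in U$, and just $x$ itself if $x \notin U$. Then $G$ has a closed path visiting every vertex of $G$ in which every vertex not in $U$ appears exactly once (i.e. an Unbounded Hamiltonian Cycle with set of designated unbounded vertices $U$) if and only if $G'$ has a Hamiltonian cycle.
   Context: A path here means a finite walk, i.e. a finite sequence of vertices $(x_1,\dots,x_\ell)$ with consecutive vertices adjacent; vertices and edges may repeat. It is closed if its first and last vertices $x_1$ and $x_\ell$ are adjacent. The number of appearances of a vertex is its number of occurrences in the sequence $(x_1,\dots,x_\ell)$. Vertices designated as unbounded are allowed to appear an arbitrary (positive, finite) number of times, possibly once; all other vertices must appear exactly once. *)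

(* Defs.v *)
From HB Require Import structures.
From mathcomp Require Import all_boot.

Set Implicit Arguments.
Unset Strict Implicit.
Unset Printing Implicit Defensive.

(* A simple graph on T : finType is a symmetric irreflexive e : rel T. Path's
   [cycle e s] says that consecutive items of s are adjacent and that its last
   item is adjacent to its first one; items of s may repeat. *)

Definition unbounded_hamiltonian_cycle (T : finType) (e : rel T) (U : {set T})
    (s : seq T) : Prop :=
  [/\ cycle e s, forall x, x \in s & forall x, x \notin U -> count_mem x s = 1].

Definition hamiltonian_cycle (T : finType) (e : rel T) (s : seq T) : Prop :=
  [/\ 3 <= size s, cycle e s, uniq s & forall x, x \in s].

Definition ncopies (T : finType) (U : {set T}) (x : T) : nat :=
  if x \in U then #|T| else 1.

(* The vertices of G': the pairs (x, i) with i < N if x is in U, and i = 0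
   otherwise. The vertices representing x are those with first component x. *)
Definition blowup_vertex (T : finType) (U : {set T}) : finType :=
  {x : T & 'I_(ncopies U x)}.

(* The cycle 0, 1, ..., n.-1, 0 on {0, ..., n.-1}, intended for 3 <= n. *)
Definition cycle_adj (n i j : nat) : bool :=
  (j == i.+1 %% n) || (i == j.+1 %% n).

Definition blowup (T : finType) (e : rel T) (U : {set T}) :
    rel (blowup_vertex U) :=
  fun p q =>
    e (tag p) (tag q)
    || [&& tag p \in U, tag q == tag p
         & cycle_adj #|T| (tagged p) (tagged q)].

Lemma blowup_sym (T : finType) (e : rel T) (U : {set T}) :
  symmetric e -> symmetric (blowup e (U := U)).
Proof.
move=> e_sym p q; rewrite /blowup /cycle_adj e_sym.
congr (_ || _); rewrite [in RHS]eq_sym [X in _ = [&& _, _ & X]]orbC.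
by case: eqP => [pq|_]; rewrite ?andbF //=; congr (_ && _); rewrite pq.
Qed.

Lemma blowup_irr (T : finType) (e : rel T) (U : {set T}) :
  irreflexive e -> 1 < #|T| -> irreflexive (blowup e (U := U)).
Proof.
move=> e_irr T_gt1 [x i]; rewrite /blowup /= e_irr eqxx /= /cycle_adj orbb.
case: (boolP (x \in U)) => //= xU.
have lt_iT : i < #|T| by rewrite (leq_trans (ltn_ord i)) // /ncopies xU.
case: (ltngtP i.+1 #|T|) => [lt_i1T| |eq_i1T].
- by rewrite modn_small // (ltn_eqF (ltnSn _)).
- by rewrite ltnS leqNgt lt_iT.
- by rewrite eq_i1T modnn; apply/eqP=> i0; rewrite -eq_i1T i0 in T_gt1.
Qed.

(* Main.v *)
Require Import Defs.
From mathcomp Require Import all_boot zify.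

Set Implicit Arguments.
Unset Strict Implicit.
Unset Printing Implicit Defensive.

(** A Hamiltonian cycle of the blow-up projects to a closed walk of the graph
once the steps inside a cycle C_u are contracted.  Conversely, cut a closed walk
at the visits of an unbounded vertex u: a block that only meets vertices met by
earlier blocks can be removed, and if u is visited more than N times such a
block exists, so we may assume that u is visited at most N times.  Then C_u can
be cut into as many nonempty subpaths as there are visits of u, and replacing
each visit by its subpath gives a Hamiltonian cycle of the blow-up. *)

(** * Shortening a closed walk to at most [#|T|] visits of each vertex *)

Section ShortWalk.

Variable T : finType.
Implicit Types (e : rel T) (U : {set T}) (u x : T) (s t : seq T).

(** If no block is covered by the earlier ones, each block brings a new vertex, so there are at most
    as many blocks as vertices met. *)
Lemma redundant_block (ws : seq (seq T)) :
  (exists A w B, ws = A ++ w :: B /\ {subset w <= flatten A})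
  \/ size ws <= #|[set x in flatten ws]|.
Proof.
elim/last_ind: ws => [|ws w IH]; first by right.
case: IH => [[A [w' [B [-> subw]]]]|le_ws].
  by left; exists A, w', (rcons B w); rewrite rcons_cat.
have [/allP subw|/allPn[x xw xNws]] := boolP (all [in flatten ws] w).
  by left; exists ws, w, [::]; rewrite cats1.
right; rewrite size_rcons (leq_ltn_trans le_ws) //; apply: proper_card.
rewrite flatten_rcons; apply/properP; split.
  by apply/subsetP => y; rewrite !inE mem_cat => ->.
by exists x; rewrite !inE ?mem_cat ?xw ?orbT //; exact: xNws.
Qed.

Lemma split_at_visits u t :
  exists ws, [/\ u :: t = flatten ws, size ws = (count_mem u t).+1
               & forall w, w \in ws -> exists w', w = u :: w'].
Proof.
elim: t => [|y t [ws [def_ws sz_ws hd_ws]]].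
  by exists [:: [:: u]]; split=> // w; rewrite inE => /eqP->; exists [::].
rewrite /=; have [->|yNu] := eqVneq y u.
  exists ([:: u] :: ws); split; rewrite /= ?sz_ws // -?def_ws //.
  by move=> w; rewrite inE => /predU1P[->|/hd_ws//]; exists [::].
case: ws def_ws sz_ws hd_ws => // w ws def_ws sz_ws hd_ws.
have [w' def_w] := hd_ws w (mem_head _ _).
move: def_ws; rewrite def_w /= => -[def_t].
exists ((u :: y :: w') :: ws); split; first by rewrite /= def_t.
  by rewrite -sz_ws.
move=> z; rewrite inE => /predU1P[->|zws]; first by exists (y :: w').
by apply: hd_ws; rewrite inE zws orbT.
Qed.

(** After [u :: a] the walk steps to [u] both before and after the removal. The condition on
    [rcons b u] covers an empty [b], where this [u] is the start of the closed walk, and a [b] that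
    begins with [u]. *)
Lemma cycle_drop_block e u a w b :
  (exists c, rcons b u = u :: c) ->
  cycle e ((u :: a) ++ (u :: w) ++ b) -> cycle e ((u :: a) ++ b).
Proof.
move=> [c bc]; rewrite /= !rcons_cat /= !rcons_cat bc !cat_path /= cat_path /=.
by case/and5P=> -> -> _ _ ->.
Qed.

Lemma unbounded_hamiltonian_cycle_rot e U s n :
  unbounded_hamiltonian_cycle e U s ->
  unbounded_hamiltonian_cycle e U (rot n s).
Proof.
case=> cyc mem_s cnt; split; first by rewrite rot_cycle.
  by move=> x; rewrite mem_rot.
by move=> x /cnt <-; apply/permP; rewrite perm_rot.
Qed.

Lemma shorten_unbounded_cycle e U s u :
  unbounded_hamiltonian_cycle e U s -> #|T| < count_mem u s ->
  exists2 s', unbounded_hamiltonian_cycle e U s' & size s' < size s.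
Proof.
move=> hs lt_u; have us : u \in s by rewrite -has_pred1 has_count; lia.
have [n t def_s] := rot_to us.
have := unbounded_hamiltonian_cycle_rot n hs.
have <- : size (rot n s) = size s by rewrite size_rot.
have : count_mem u s = count_mem u (u :: t).
  by rewrite -def_s; apply/esym/permP; rewrite perm_rot.
rewrite def_s => cnt_u [cyc mem_s cnt]; rewrite /= eqxx add1n in cnt_u.
have [ws [def_ws sz_ws hd_ws]] := split_at_visits u t.
case: (redundant_block ws) => [[A [w [B [def_w sub_w]]]]|]; last first.
  by move/leq_trans/(_ (max_card _)); rewrite sz_ws -cnt_u leqNgt lt_u.
have [w' w_u] : exists w', w = u :: w'.
  by apply: hd_ws; rewrite def_w mem_cat mem_head orbT.
(* [A] is not empty, since the vertex [u] of [w] must occur in it. *)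
have [a A_u] : exists a, flatten A = u :: a.
  case: A def_w sub_w => [_ /(_ u)|v A def_w _]; first by rewrite w_u mem_head => /(_ isT).
  have [v' ->] : exists v', v = u :: v' by apply: hd_ws; rewrite def_w mem_head.
  by exists (v' ++ flatten A).
have [c B_u] : exists c, rcons (flatten B) u = u :: c.
  case: B def_w => [_|v B def_w]; first by exists [::].
  have [v' ->] : exists v', v = u :: v'.
    by apply: hd_ws; rewrite def_w mem_cat !inE eqxx !orbT.
  by exists (rcons (v' ++ flatten B) u).
have def_s' : u :: t = flatten A ++ w ++ flatten B.
  by rewrite def_ws def_w flatten_cat.
rewrite def_s' in cyc mem_s cnt *; exists (flatten A ++ flatten B); last first.
  by rewrite !size_cat w_u /=; lia.
split.
- by rewrite A_u in cyc *; rewrite w_u in cyc; apply: cycle_drop_block cyc; exists c.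
- move=> x; have := mem_s x; rewrite !mem_cat => /or3P[->|/sub_w->|->] //.
  by rewrite orbT.
(* A vertex outside [U] lying in [w] would also lie in [flatten A], hence occur twice in the
   walk. *)
- move=> x xU; move: (cnt x xU); rewrite !count_cat.
  have [xw|xNw] := boolP (x \in w); last first.
    by rewrite [count_mem x w](count_memPn xNw).
  have: 0 < count_mem x w by rewrite -has_count has_pred1.
  have: 0 < count_mem x (flatten A) by rewrite -has_count has_pred1 sub_w.
  lia.
Qed.

Lemma short_unbounded_cycle e U s :
  unbounded_hamiltonian_cycle e U s ->
  exists2 s', unbounded_hamiltonian_cycle e U s'
            & forall u, count_mem u s' <= #|T|.
Proof.
have [n] := ubnP (size s); elim: n s => // n IH s lt_sn hs.
have [/forallP le_s|/forallPn[u]] :=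
  boolP [forall u, count_mem u s <= #|T|]; first by exists s.
rewrite -ltnNge => /(shorten_unbounded_cycle hs)[s' hs' lt_s'].
by apply: IH hs'; lia.
Qed.

End ShortWalk.

(** * From a short closed walk to a Hamiltonian cycle of the blow-up *)

Section Expand.

Variables (T : finType) (e : rel T) (U : {set T}).
Implicit Types (x : T) (t : seq T) (p : blowup_vertex U).

Lemma ncopies_gt0 x : 0 < ncopies U x.
Proof. by rewrite /ncopies; case: ifP => // _; apply/card_gt0P; exists x. Qed.

(** Indices out of range are dropped by [insub], so no bound on [a + m] is required here. *)
Definition interval_copies x a m : seq (blowup_vertex U) :=
  [seq Tagged (fun y => 'I_(ncopies U y)) i
     | i <- pmap (insub : nat -> option 'I_(ncopies U x)) (iota a m)].

Lemma mem_interval_copies x a m p :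
  (p \in interval_copies x a m) = (tag p == x) && (a <= tagged p < a + m).
Proof.
apply/mapP/andP => [[j]|[]].
  by rewrite mem_pmap_sub mem_iota => ran_j ->; rewrite eqxx.
case: p => y i /= /eqP yx; case: _ / yx => ran.
by exists i => //; rewrite mem_pmap_sub mem_iota.
Qed.

Lemma uniq_interval_copies x a m : uniq (interval_copies x a m).
Proof.
rewrite map_inj_uniq ?pmap_sub_uniq ?iota_uniq //.
by move=> i j /eqP; rewrite eq_Tagged => /eqP.
Qed.

Lemma sorted_interval_copies x a m :
  a + m <= ncopies U x -> sorted (@blowup T e U) (interval_copies x a m).
Proof.
move=> le_n; rewrite sorted_map.
have : sorted (fun i j : nat => j == i.+1)
         (map val (pmap (insub : nat -> option 'I_(ncopies U x)) (iota a m))).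
  rewrite (pmap_filter (insubK _)) (all_filterP _).
    by case: {le_n} m => //= m; elim: m a => //= m IH a; rewrite eqxx IH.
  by apply/allP => i; rewrite mem_iota /= isSome_insub; lia.
rewrite sorted_map; apply: sub_sorted => i j /= /eqP ij.
(* For [x] in [U] this bound rules out wrap-around; otherwise there is one copy and no consecutive
   pair. *)
have := ltn_ord (j : 'I_(ncopies U x)).
rewrite /blowup /= eqxx /= /cycle_adj {}ij [X in _ < X]/ncopies.
by case: (x \in U) => //= lt_iT; rewrite modn_small ?eqxx ?orbT.
Qed.

(* If x is visited k x times in all, its last visit (c = 0 visits to come)
   receives the copies 0, ..., n - k x, and an earlier one the copy n - c. *)
Definition visit_copies (k : T -> nat) x c :=
  if c == 0 then interval_copies x 0 (ncopies U x - k x).+1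
  else interval_copies x (ncopies U x - c) 1.

(** Numbering visits by those still to come lets the recursion look at the tail only, while [k]
    stays fixed. *)
Fixpoint expand (k : T -> nat) t : seq (blowup_vertex U) :=
  if t is x :: t' then visit_copies k x (count_mem x t') ++ expand k t'
  else [::].

Lemma visit_copies_tag k x c p : p \in visit_copies k x c -> tag p = x.
Proof.
by rewrite /visit_copies; case: ifP => _;
   rewrite mem_interval_copies => /andP[/eqP].
Qed.

Lemma uniq_visit_copies k x c : uniq (visit_copies k x c).
Proof. by rewrite /visit_copies; case: ifP; rewrite uniq_interval_copies. Qed.

(** Each visit of [x] becomes a nonempty path with both ends among the copies of [x], so it can
    stand for [x] in a walk. *)
Lemma visit_copies_path k x c : 0 < k x ->
  exists p q, [/\ visit_copies k x c = p :: q, tag p = x,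
                  path (@blowup T e U) p q & tag (last p q) = x].
Proof.
move=> k_gt0; have n_gt0 := ncopies_gt0 x.
have : sorted (@blowup T e U) (visit_copies k x c).
  by rewrite /visit_copies; case: eqP => c0; apply: sorted_interval_copies; lia.
have tag_x := @visit_copies_tag k x c.
have : exists p, p \in visit_copies k x c.
  rewrite /visit_copies; case: eqP => c0.
    by exists (Tagged (fun y => 'I_(ncopies U y)) (Ordinal n_gt0));
       rewrite mem_interval_copies eqxx.
  have lt_n : ncopies U x - c < ncopies U x by lia.
  exists (Tagged (fun y => 'I_(ncopies U y)) (Ordinal lt_n)).
  by rewrite mem_interval_copies eqxx /=; lia.
case: (visit_copies k x c) tag_x => [_ []//|p q tag_x _ pq].
by exists p, q; split=> //; apply: tag_x; rewrite ?mem_head ?mem_last.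
Qed.

(** With n copies, k visits in all and c > 0 of them in [t], the last visit covers 0, ..., n - k and
    the others n - c + 1, ..., n - 1; one more visit in front adds n - c. *)
Lemma mem_expand k t p :
    0 < k (tag p) <= ncopies U (tag p) -> count_mem (tag p) t <= k (tag p) ->
  (p \in expand k t) = (0 < count_mem (tag p) t)
    && ((tagged p <= ncopies U (tag p) - k (tag p))
        || (ncopies U (tag p) < tagged p + count_mem (tag p) t)).
Proof.
move=> k_ok; elim: t => //= x t IH le_k; rewrite mem_cat IH; last lia.
have lt_p := ltn_ord (tagged p).
have [xp|xNp] /= := eqVneq x (tag p).
  rewrite xp in le_k *; rewrite eqxx in le_k.
  by rewrite /visit_copies; case: eqP => c0;
     rewrite mem_interval_copies eqxx /=; move: (nat_of_ord _) k_ok lt_p le_k c0;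
     move: (count_mem _ _) (k _) (ncopies _ _) => c kp n i; lia.
rewrite add0n; case: (boolP (p \in visit_copies k x _)) => // /visit_copies_tag px.
by rewrite px eqxx in xNp.
Qed.

Lemma uniq_expand k t :
    (forall x, 0 < k x <= ncopies U x) -> (forall x, count_mem x t <= k x) ->
  uniq (expand k t).
Proof.
move=> k_ok; elim: t => //= x t IH le_k.
have le_kt y : count_mem y t <= k y by apply: leq_trans (le_k y); exact: leq_addl.
(* With c > 0 visits to come, the new copy n - c lies strictly between the two ranges used by [t],
   as c < k; with c = 0 no copy is used yet. *)
rewrite cat_uniq uniq_visit_copies IH // andbT; apply/hasPn => p.
rewrite mem_expand // => p_t; apply/negP => p_x.
have px := visit_copies_tag p_x; have := le_k x; have := k_ok x.
rewrite eqxx; move: p_t p_x; rewrite /visit_copies -px.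
by case: eqP; rewrite mem_interval_copies eqxx /=;
   move: (ncopies _ _) (count_mem _ _) (k _) (nat_of_ord _) => n c kp i; lia.
Qed.

Lemma blowup_edge p q : e (tag p) (tag q) -> blowup e p q.
Proof. by rewrite /blowup => ->. Qed.

(** Edges between copies of adjacent vertices depend on tags only, so the tag of the last vertex is
    all that the induction must carry. *)
Lemma path_expand k p t : (forall x, 0 < k x) -> path e (tag p) t ->
  path (@blowup T e U) p (expand k t)
  /\ tag (last p (expand k t)) = last (tag p) t.
Proof.
move=> k_gt0; elim: t p => //= x t IH p /andP[epx xt].
have [q [r [-> qx qr rx]]] := visit_copies_path (count_mem x t) (k_gt0 x).
rewrite -rx in xt; have [pathr lastr] := IH _ xt.
by rewrite /= last_cat cat_path qr pathr lastr rx blowup_edge // qx.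
Qed.

Lemma cycle_expand k t :
  (forall x, 0 < k x) -> cycle e t -> cycle (@blowup T e U) (expand k t).
Proof.
move=> k_gt0; case: t => //= x t.
have [p [q [-> px pq qx]]] := visit_copies_path (count_mem x t) (k_gt0 x).
rewrite rcons_path => /andP[xt ex]; rewrite -qx in xt.
have [pathq lastq] := path_expand k_gt0 xt.
by rewrite /= rcons_path cat_path pq pathq last_cat blowup_edge // lastq qx px.
Qed.

Lemma hamiltonian_cycle_expand s :
    2 < #|T| -> unbounded_hamiltonian_cycle e U s ->
    (forall u, count_mem u s <= #|T|) ->
  hamiltonian_cycle (@blowup T e U) (expand (fun x => count_mem x s) s).
Proof.
move=> T_gt2 [cyc mem_s cnt] le_T; pose k := fun x => count_mem x s.
have k_gt0 x : 0 < k x by rewrite -has_count has_pred1.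
have k_ok x : 0 < k x <= ncopies U x.
  rewrite k_gt0 /ncopies; case: ifP => [_|/negbT/cnt xU]; first exact: le_T.
  by rewrite /k xU.
(* When all k visits are counted, the two ranges i <= n - k and n < i + k exhaust the indices. *)
have mem_e p : p \in expand k s.
  rewrite mem_expand //.
  have := k_ok (tag p); rewrite -/(k (tag p)); lia.
split=> //; [|exact: cycle_expand|by apply: uniq_expand].
(* The tags run through all of [T], which gives length at least 3. *)
have sub_T : {subset enum predT <= map tag (expand k s)}.
  move=> x _; apply/mapP.
  by exists (Tagged (fun y => 'I_(ncopies U y)) (Ordinal (ncopies_gt0 x))).
rewrite (leq_trans T_gt2) // cardT -(size_map tag).
exact: uniq_leq_size (enum_uniq _) sub_T.
Qed.

End Expand.

(** * From a Hamiltonian cycle of the blow-up to a closed walk *)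

Section Project.

Variables (T : finType) (e : rel T) (U : {set T}).

(** Steps that stay in place are dropped; they only repeat vertices of [U], so counts outside [U] do
    not change. *)
Lemma contract_path x t :
    path (fun y z => e y z || (y == z) && (y \in U)) x t ->
  exists t', [/\ path e x t', last x t' = last x t, x :: t' =i x :: t
               & forall y, y \notin U -> count_mem y t' = count_mem y t].
Proof.
elim: t x => [|y t IH] x /=; first by exists [::].
case/andP => xy /IH[t' [path_t' last_t' mem_t' cnt_t']].
case/orP: xy => [exy|/andP[/eqP xy xU]].
  exists (y :: t'); split=> //=; first by rewrite exy.
    by move=> z; rewrite inE mem_t' inE.
  by move=> z /cnt_t' ->.
exists t'; rewrite {}xy in xU *; split=> // [z|z zU].
  by rewrite mem_t' !inE orbA orbb.
by rewrite cnt_t' //; case: eqP zU => // <-; rewrite xU.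
Qed.

Lemma contract_cycle s :
    1 < #|T| -> cycle (fun y z => e y z || (y == z) && (y \in U)) s ->
    (forall x, x \in s) -> (forall x, x \notin U -> count_mem x s = 1) ->
  exists s', unbounded_hamiltonian_cycle e U s'.
Proof.
case: s => [T_gt1 _ s0|x t T_gt1 /contract_path].
  by have /card_gt0P[x] := ltnW T_gt1; have := s0 x.
case=> t' [path_t' last_t' mem_t' cnt_t'] mem_s cnt.
have mem_xt' y : y \in x :: t'.
  by have := mem_s y; rewrite mem_t' !inE mem_rcons inE => /orP[->|->]; rewrite ?orbT.
(* The contracted path returns to [x]; its last entry is removed to get a closed walk. It is not
   empty because [T] has two distinct vertices. *)
case/lastP: t' => [|t' z] in path_t' last_t' mem_t' cnt_t' mem_xt' *.
  have /card_gt1P[y [z [_ _]]] := T_gt1.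
  by have := mem_xt' y; have := mem_xt' z; rewrite !inE => /eqP-> /eqP->; rewrite eqxx.
move: last_t'; rewrite !last_rcons => zx; rewrite {}zx in path_t' mem_t' cnt_t' mem_xt'.
exists (x :: t'); split=> //.
  by move=> y; have := mem_xt' y; rewrite !inE mem_rcons inE orbA orbb.
move=> y yU; rewrite -(cnt y yU); have := cnt_t' y yU.
by rewrite -!cats1 !count_cat /=; lia.
Qed.

Lemma blowup_vertex_bounded (p q : blowup_vertex U) :
  tag p \notin U -> tag p = tag q -> p = q.
Proof.
case: p q => [x i] [y j] /= xU xy; case: _ / xy j => j.
have ncopies1 : ncopies U x = 1 by rewrite /ncopies (negbTE xU).
congr existT; apply: val_inj => /=.
by have := ltn_ord i; have := ltn_ord j; move: (nat_of_ord i) (nat_of_ord j) => m n; lia.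
Qed.

Lemma unbounded_cycle_of_blowup s :
    1 < #|T| -> hamiltonian_cycle (@blowup T e U) s ->
  exists s', unbounded_hamiltonian_cycle e U s'.
Proof.
move=> T_gt1 [_ cyc uniq_s mem_s].
pose copy0 x : blowup_vertex U :=
  Tagged (fun y => 'I_(ncopies U y)) (Ordinal (ncopies_gt0 U x)).
apply: (@contract_cycle (map tag s)) => //.
- rewrite cycle_map; apply: sub_cycle cyc => p q /= /orP[->//|/and3P[pU /eqP qp _]].
  by rewrite qp eqxx pU orbT.
- by move=> x; apply/mapP; exists (copy0 x).
(* Outside [U] only [copy0 x] projects to [x], and it occurs once in [s]. *)
- move=> x xU; rewrite count_map -[RHS](_ : count_mem (copy0 x) s = 1).
    apply: eq_count => p /=; apply/eqP/eqP => [px|-> //].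
    by apply: blowup_vertex_bounded; rewrite px.
  by rewrite count_uniq_mem ?mem_s.
Qed.

End Project.

Theorem mainTheorem6 (T : finType) (e : rel T) (U : {set T})
    (e_sym : symmetric e) (e_irr : irreflexive e) (card_ge3 : 3 <= #|T|) :
  (exists s : seq T, unbounded_hamiltonian_cycle e U s) <->
  (exists s : seq (blowup_vertex U), hamiltonian_cycle (@blowup T e U) s).
Proof.
split=> [[s /short_unbounded_cycle[s' hs' le_s']]|[s]].
  by exists (expand U (fun x => count_mem x s') s'); apply: hamiltonian_cycle_expand.
exact: unbounded_cycle_of_blowup (ltnW card_ge3).
Qed.
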